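(* Let $X$ be a real vector space of finite dimension $\ge2$. The map $\Omega_X\to\widehat{\mathcal{E}(X)}$ defined by $(a,\overrightarrow\alpha)\mapsto\chi_{a,\overrightarrow\alpha}$, where $\chi_{a,\overrightarrow\alpha}(u)=\tau_{\overrightarrow\alpha}(u)(a)$ for $u\in\mathcal{E}(X)$, is bijective.
   Context: Half-lines: for a finite-dimensional real vector space $E$ and $a\in E\setminus\{0\}$ put $\hat a=\{ra: r>0\}$; $\mathbb{S}_E$ is the set of all half-lines; for $\alpha\in\mathbb{S}_E$, $[\alpha]$ is the line in $E$ generated by $\alpha$. Limits at a half-line: a cone in $E$ is a union of half-lines, a truncated cone is the intersection of a cone with the complement of a bounded set, and $\alpha\in\mathbb{S}_E$ is eventually in a truncated cone $C$ if there is $a\in\alpha$ with $\lambda a\in C$ for all $\lambda\ge1$. For $u:E\to\mathbb{C}$, $\lim_{x\to\alpha}u(x)=c$ means: for every $\varepsilon>0$ there is an open truncated cone $C$ such that $\alpha$ is eventually in $C$ and $|u(x)-c|<\varepsilon$ for $x\in C$. $\mathcal{C}(\overline{E})$ denotes the algebra of continuous $u:E\to\mathbb{C}$ such that $\lim_{x\to\alpha}u(x)$ exists for each $\alpha\in\mathbb{S}_E$. For a linear subspace $Y\subset E$, $\pi_Y:E\to E/Y$ is the canonical projection and $u$ on $E/Y$ is identified with $u\circ\pi_Y$ on $E$. $\mathcal{E}(E)$ is the sup-norm closed algebra generated by all $\mathcal{C}(\overline{E/Y})$, $Y$ running over all linear subspaces of $E$. Under the identification, $\mathcal{E}(X/Z)$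 is the $C^*$-subalgebra of $\mathcal{E}(X)$ generated by the $\mathcal{C}(\overline{X/Y})$ with $Y\supset Z$. $\widehat{\mathcal{E}(X)}$ is the set of characters (nonzero algebra morphisms to $\mathbb{C}$) of $\mathcal{E}(X)$. For $\alpha\in\mathbb{S}_E$, $a\in\alpha$ and $u\in\mathcal{E}(E)$, $\tau_\alpha(u)(x):=\lim_{r\to+\infty}u(ra+x)$; this limit exists, is independent of $a\in\alpha$, and $\tau_\alpha$ is a morphism from $\mathcal{E}(E)$ onto $\mathcal{E}(E/[\alpha])$. Sequences: for $0\le n\le\dim X$ define recursively sequences $\overrightarrow\alpha=(\alpha_1,\dots,\alpha_n)$ and subspaces $[\overrightarrow\alpha]=[\alpha_1,\dots,\alpha_n]\subset X$ of dimension $n$: for $n=0$, $\overrightarrow\alpha=\emptyset$ and $[\emptyset]=\{0\}$; for $n\ge1$, $\alpha_n\in\mathbb{S}_{X/[\alpha_1,\dots,\alpha_{n-1}]}$ and $[\alpha_1,\dots,\alpha_n]=\pi_Y^{-1}([\alpha_n])$ with $Y=[\alpha_1,\dots,\alpha_{n-1}]$, so that $X/[\alpha_1,\dots,\alpha_n]=(X/[\alpha_1,\dots,\alpha_{n-1}])/[\alpha_n]$. $\Omega_X$ is the set of all pairs $(a,\overrightarrow\alpha)$ with $\overrightarrow\alpha$ such a sequence of some length $0\le n\le\dim X$ and $a\in X/[\overrightarrow\alpha]$. Put $\tau_{\overrightarrow\alpha}=\tau_{\alpha_n}\tau_{\alpha_{n-1}}\cdots\tau_{\alpha_1}:\mathcal{E}(X)\to\mathcal{E}(X/[\overrightarrow\alpha])$,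 where $\tau_{\alpha_j}:\mathcal{E}(X/[\alpha_1,\dots,\alpha_{j-1}])\to\mathcal{E}(X/[\alpha_1,\dots,\alpha_j])$, and $\tau_\emptyset=\mathrm{id}$. Elements of $\mathcal{E}(X/[\overrightarrow\alpha])$ are evaluated at $a\in X/[\overrightarrow\alpha]$ as functions on $X/[\overrightarrow\alpha]$. *)

(* Defs.v *)
From HB Require Import structures.
From mathcomp Require Import all_boot all_order all_algebra.
From mathcomp Require Import generic_quotient ring_quotient complex.
From mathcomp Require Import all_classical all_reals all_analysis.

Set Implicit Arguments.
Unset Strict Implicit.
Unset Printing Implicit Defensive.

Import Order.TTheory GRing.Theory Num.Theory.
Import numFieldNormedType.Exports.

Local Open Scope classical_set_scope.
Local Open Scope ring_scope.
Local Open Scope quotient_scope.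
Local Open Scope complex_scope.

(* The quotient E / Y of a finite-dimensional vector space by a subspace, with
   its canonical projection prv Y; repr chooses a representative of a class. *)
Section Quotv.
Context {K : fieldType} {E : vectType K}.
Implicit Type Y : {vspace E}.

Definition quotv Y : Type := Quotient.quot (pred_of_vspace Y).

HB.instance Definition _ Y := GRing.Zmodule.on (quotv Y).
HB.instance Definition _ Y := EqQuotient.on (quotv Y).

Definition prv Y (x : E) : quotv Y := \pi_(quotv Y) x.

Lemma prv_repr Y (z : quotv Y) : prv Y (repr z) = z.
Proof. exact: reprK. Qed.

Lemma prv_eqP Y x y : reflect (prv Y x = prv Y y) (x - y \in Y).
Proof. by rewrite [x - y \in Y]Quotient.idealrBE; apply: eqP. Qed.

Lemma prvD Y x y : prv Y (x + y) = prv Y x + prv Y y.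
Proof. by rewrite /prv !piE. Qed.

Definition scaleq Y (k : K) (z : quotv Y) : quotv Y := prv Y (k *: repr z).

Lemma prvZ Y k x : prv Y (k *: x) = scaleq k (prv Y x).
Proof.
by apply/prv_eqP; rewrite -scalerBr rpredZ//; apply/prv_eqP; rewrite prv_repr.
Qed.

Lemma scaleqA Y a b (z : quotv Y) : scaleq a (scaleq b z) = scaleq (a * b) z.
Proof. by rewrite -[z]prv_repr -!prvZ scalerA. Qed.

Lemma scale1q Y : left_id 1 (@scaleq Y).
Proof. by move=> z; rewrite -[z]prv_repr -!prvZ scale1r. Qed.

Lemma scaleqDr Y : right_distributive (@scaleq Y) +%R.
Proof.
move=> k z t.
by rewrite -[z]prv_repr -[t]prv_repr -prvD -!prvZ -prvD scalerDr.
Qed.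

Lemma scaleqDl Y z : {morph (@scaleq Y)^~ z : a b / a + b}.
Proof. by move=> a b; rewrite -[z]prv_repr -!prvZ -prvD scalerDl. Qed.

HB.instance Definition _ Y := GRing.Zmodule_isLmodule.Build K (quotv Y)
  (@scaleqA Y) (@scale1q Y) (@scaleqDr Y) (@scaleqDl Y).

Lemma prv_is_linear Y : linear (prv Y).
Proof. by move=> k x y; rewrite prvD prvZ. Qed.

HB.instance Definition _ Y := GRing.isSemilinear.Build K E (quotv Y) _ (prv Y)
  (GRing.semilinear_linear (@prv_is_linear Y)).

Lemma quotv_vect_iso Y : Vector.axiom (\dim Y^C) (quotv Y).
Proof.
have YC0 : (Y^C :&: Y = 0)%VS by rewrite capvC capv_compl.
have Y0 x : x \in Y -> daddv_pi Y^C Y x = 0.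
  move=> xY; have := daddv_pi_add YC0 (w := x).
  rewrite addvC addv_complf memvf => /(_ isT).
  rewrite [daddv_pi Y _ x]daddv_pi_id ?capv_compl// => /(canRL (addrK _)).
  by rewrite subrr.
have piE x : daddv_pi Y^C Y (repr (prv Y x)) = daddv_pi Y^C Y x.
  by apply/subr0_eq; rewrite -raddfB; apply/Y0/prv_eqP/prv_repr.
pose c (z : quotv Y) := daddv_pi Y^C Y (repr z).
exists (fun z => \row_i coord (vbasis Y^C) i (c z)).
  move=> k z t; apply/rowP => i; rewrite !mxE -linearP; congr (coord _ _ _).
  by rewrite /c -linearP -[z in LHS]prv_repr -[t in LHS]prv_repr -linearP piE.
exists (fun r : 'rV_(\dim Y^C) => prv Y (\sum_i r 0 i *: (vbasis Y^C)`_i)).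
  move=> z; rewrite -[RHS]prv_repr -[repr z in RHS](daddv_pi_add YC0);
    last by rewrite addvC addv_complf memvf.
  rewrite [in RHS]linearD/= [X in _ + X](_ : _ = 0) ?addr0.
    rewrite -/(c z) [c z in RHS](coord_vbasis (memv_pi _ _ _)).
    by congr (prv Y _); apply: eq_bigr => i _; rewrite mxE.
  rewrite -(linear0 (prv Y)); apply/prv_eqP.
  by rewrite subr0 memv_pi.
move=> r; apply/rowP => i; rewrite mxE /c piE daddv_pi_id//.
  by rewrite coord_sum_free ?(basis_free (vbasisP _)).
by apply: rpred_sum => j _; rewrite rpredZ ?vbasis_mem ?memt_nth.
Qed.

HB.instance Definition _ Y :=
  Lmodule_hasFinDim.Build K (quotv Y) (quotv_vect_iso Y).

End Quotv.

(* A finite-dimensional real vector space carries its usual topology and bounded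
   sets, those of R^n through any system of linear coordinates; the library puts
   no topology on vectType, so we transport them along the basis vbasis fullv. *)
Section Topology.
Context {R : realType} {E : vectType R}.

Definition of_coord (v : 'rV[R]_(\dim {:E})) : E :=
  passmx.vecof (vbasis fullv) v.

Definition vopen (A : set E) := open (of_coord @^-1` A).

Definition vbounded (A : set E) := bounded_set (of_coord @^-1` A).

Definition vcontinuous (u : E -> R[i]) :=
  continuous ((u : E -> R[i]^o) \o of_coord).

End Topology.

Section HalfLines.
Context {R : realType} {E : vectType R}.

Definition ray (a : E) : set E := [set r *: a | r in [set r : R | 0 < r]].

End HalfLines.

Record halfline (R : realType) (E : vectType R) := HalfLine {
  hl_set :> set E;
  hl_ray : exists2 a, a != 0 & hl_set = ray a }.

Section Limits.
Context {R : realType} {E : vectType R}.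
Implicit Types (alpha : halfline E) (C : set E) (u : E -> R[i]) (c : R[i]).

Definition hl_pt alpha : E := xget 0 (alpha : set E).

Definition hl_line alpha : {vspace E} := <[hl_pt alpha]>%VS.

Definition cone C :=
  exists H : set (halfline E), C = \bigcup_(alpha in H) (alpha : set E).

Definition truncated_cone C :=
  exists C0 B, [/\ cone C0, vbounded B & C = C0 `&` ~` B].

Definition eventually_in alpha C :=
  exists2 a, (alpha : set E) a & forall l : R, 1 <= l -> C (l *: a).

Definition lim_halfline u alpha c :=
  forall eps : R, 0 < eps -> exists C,
    [/\ vopen C, truncated_cone C, eventually_in alpha C
      & forall x, C x -> `|u x - c| < eps%:C].

Definition Cbar : set (E -> R[i]) :=
  [set u | vcontinuous u /\ forall alpha, exists c, lim_halfline u alpha c].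

(* On the algebra below the limit exists and does not depend on the point chosen
   in alpha. *)
Definition tau alpha u : E -> R[i] :=
  fun x => lim ((u (r *: hl_pt alpha + x) : R[i]^o) @[r --> +oo%R]).

End Limits.

Arguments Cbar {R} E.

Section Algebra.
Context {R : realType}.
Variable E : vectType R.
Implicit Types (u v : E -> R[i]) (A : set (E -> R[i])).

Definition sup_closed A :=
  forall u, (forall eps : R, 0 < eps ->
    exists2 v, A v & forall x, `|u x - v x| <= eps%:C) -> A u.

Definition closed_subalgebra A :=
  [/\ forall u v, A u -> A v -> A (u + v),
      forall k u, A u -> A (k *: u),
      forall u v, A u -> A v -> A (u * v)
    & sup_closed A].

(* C(E/Y), regarded as a set of functions on E *)
Definition Cbar_quot (Y : {vspace E}) : set (E -> R[i]) :=
  [set v \o prv Y | v in Cbar (quotv Y)].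

Definition calE : set (E -> R[i]) :=
  smallest closed_subalgebra (\bigcup_Y Cbar_quot Y).

Lemma calE_closed : closed_subalgebra calE.
Proof.
split=> [u v Eu Ev A AP|k u Eu A AP|u v Eu Ev A AP|u Eu A AP].
- by case: (AP) => -[+ _ _ _] _; apply; [apply: Eu|apply: Ev].
- by case: (AP) => -[_ + _ _] _; apply; apply: Eu.
- by case: (AP) => -[_ _ + _] _; apply; [apply: Eu|apply: Ev].
- case: (AP) => -[_ _ _ +] _; apply => eps /Eu[v Ev uv].
  by exists v => //; apply: Ev.
Qed.

Lemma calE1 : calE 1.
Proof.
apply: sub_gen_smallest; exists fullv => //; exists (cst 1) => //; split.
  exact: cst_continuous.
move=> alpha; have [a /eqP[]] := hl_ray alpha.
by rewrite -[a]prv_repr -(linear0 (prv fullv)); apply/prv_eqP; rewrite memvf.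
Qed.

Definition in_calE : {pred E -> R[i]} := [pred u | `[< calE u >]].

Lemma in_calE_zmod : zmod_closed in_calE.
Proof.
have [ED EZ _ _] := calE_closed.
split=> [|u v /asboolP Eu /asboolP Ev]; apply/asboolP.
  by have := EZ 0 1 calE1; rewrite scale0r.
by apply: ED => //; have := EZ (-1) v Ev; rewrite scaleN1r.
Qed.

Lemma in_calE_scale : scaler_closed in_calE.
Proof.
have [_ EZ _ _] := calE_closed.
by move=> k u /asboolP Eu; apply/asboolP; apply: EZ.
Qed.

Lemma in_calE_mul : mulr_closed in_calE.
Proof.
have [_ _ EM _] := calE_closed.
split=> [|u v /asboolP Eu /asboolP Ev]; apply/asboolP; first exact: calE1.
exact: EM.
Qed.

HB.instance Definition _ := GRing.isZmodClosed.Build _ in_calE in_calE_zmod.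
HB.instance Definition _ := GRing.isScaleClosed.Build _ _ in_calE in_calE_scale.
HB.instance Definition _ := GRing.isMulClosed.Build _ in_calE in_calE_mul.

Record calE_type := CalE { calE_fun :> E -> R[i]; _ : calE_fun \in in_calE }.

HB.instance Definition _ := [isSub for calE_fun].
HB.instance Definition _ := [Choice of calE_type by <:].
HB.instance Definition _ :=
  GRing.SubChoice_isSubComPzRing.Build _ _ calE_type (subringClosedP in_calE).
HB.instance Definition _ := [SubZmodule_isSubLmodule of calE_type by <:].

Definition character (chi : calE_type -> R[i]) :=
  [/\ scalar chi, {morph chi : f g / f * g} & exists f, chi f != 0].

End Algebra.

(* hlseq Y is the type of the sequences (alpha_1, ..., alpha_n) with
   [alpha_1, ..., alpha_n] = Y. Since half-lines exist only in nonzero spaces,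
   their length n = \dim Y is at most the dimension of X. *)
Inductive hlseq (R : realType) (X : vectType R) : {vspace X} -> Type :=
| hlnil : hlseq 0%VS
| hlcons (Y : {vspace X}) (s : hlseq Y) (alpha : halfline (quotv Y)) :
    hlseq (linfun (prv Y) @^-1: hl_line alpha)%VS.

Definition Omega (R : realType) (X : vectType R) : Type :=
  {Y : {vspace X} & (quotv Y * hlseq Y)%type}.

Section TauSeq.
Context {R : realType} {X : vectType R}.

(* tau alpha, for alpha in S_(X/Y), sends functions on X/Y to functions on X/Y
   invariant under [alpha], i.e. to functions on X/Y' with Y' the preimage of
   [alpha]; these are evaluated at z in X/Y' through a representative of z. For
   the empty sequence, Y = 0 and X/0 is identified with X in the same way. *)
Fixpoint tau_seq (Y : {vspace X}) (s : hlseq Y) (u : X -> R[i]) :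
    quotv Y -> R[i] :=
  match s with
  | hlnil => fun z => u (repr z)
  | hlcons Y0 s0 alpha => fun z => tau alpha (tau_seq s0 u) (prv Y0 (repr z))
  end.

Definition chi (p : Omega X) : calE_type X -> R[i] :=
  fun u => tau_seq (projT2 p).2 u (projT2 p).1.

End TauSeq.

(* Main.v *)
Require Import Defs.
From HB Require Import structures.
From mathcomp Require Import all_boot all_order all_algebra.
From mathcomp Require Import generic_quotient ring_quotient complex.
From mathcomp Require Import all_classical all_reals all_analysis.
From mathcomp Require Import ring lra.

(** Every limit in this theory is a limit along a filter on [X], and characters
    are best described by the filters that produce them.

    Let [bar E] be the disjoint union of a space [E] and of its set of
    half-lines. The map [x |-> x / (1 + |x|)] embeds [E] as the open unit ball;
    sending each half-line to its direction on the unit sphere identifies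
    [bar E] with the closed unit ball, which is compact and Hausdorff. Functions
    in [Cbar E] extend continuously to [bar E] ([vcontinuous_tends],
    [lim_halfline_tends]), and the coordinates of the embedding are themselves
    in [Cbar E] ([to_ball_Cbar]), so [Cbar E] separates the points of [bar E].

    Say that a filter [F] on [X] converges to [(a, (alpha_1, .., alpha_n))] if,
    for each [k], its image in [X / [alpha_1, .., alpha_(k-1)]] tends to the
    half-line [alpha_k], and its image in [X / [alpha_1, .., alpha_n]] tends to
    the point [a]. Then for every subspace [W] the image of [F] in [X / W] has a
    limit in the compactification of [X / W], determined by the element of
    [Omega X] alone ([converges_to_tends]): if [W] contains
    [[alpha_1, .., alpha_n]] it is the image of [a]; otherwise, for the least
    [k] such that [W] does not contain [[alpha_1, .., alpha_k]], it is the image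
    of [alpha_k], which is a half-line of [X / W]. Consequently each function
    in the algebra has, along all filters converging to [p], one common limit.
    The iterated limit that defines [chi p] is the limit along one such filter
    ([iterated_converges], [tau_seq_iterated]), so this common limit is [chi p].

    Limits along a proper filter are characters. Surjectivity holds because each
    character is the limit along some ultrafilter ([character_limit]) and each
    ultrafilter on [X] converges to some [p] ([ultra_converges]): by compactness
    its image in a quotient of [X] tends to a point, or else to a half-line, and
    then one passes to a further quotient of smaller dimension. For injectivity,
    if [chi p = chi q] then, by separation, a filter converging to [q] also
    converges to [p]; but a proper filter converges to at most one element
    of [Omega X] ([converges_to_unique]). *)

Set Implicit Arguments.
Unset Strict Implicit.
Unset Printing Implicit Defensive.

Import Order.TTheory GRing.Theory Num.Theory.
Import numFieldNormedType.Exports.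
Import passmx.

Local Open Scope classical_set_scope.
Local Open Scope ring_scope.
Local Open Scope complex_scope.

Local Notation Re := complex.Re.
Local Notation Im := complex.Im.
Local Notation rv := (rVof (vbasis fullv)).
Local Notation preline alpha := (linfun (prv _) @^-1: hl_line alpha)%VS.

(** * Limits of complex functions along a filter *)
Section ComplexLimits.
Context {R : realType}.
Implicit Types c d : R[i].

Lemma ReB c d : Re (c - d) = Re c - Re d.
Proof. by case: c; case: d. Qed.

Lemma ImB c d : Im (c - d) = Im c - Im d.
Proof. by case: c; case: d. Qed.

Lemma ReD c d : Re (c + d) = Re c + Re d.
Proof. by case: c; case: d. Qed.

Lemma ImD c d : Im (c + d) = Im c + Im d.
Proof. by case: c; case: d. Qed.

Lemma ReM c d : Re (c * d) = Re c * Re d - Im c * Im d.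
Proof. by case: c; case: d. Qed.

Lemma ImM c d : Im (c * d) = Re c * Im d + Im c * Re d.
Proof. by case: c; case: d. Qed.

Lemma le_normc_ReIm c : `|c| <= (`|Re c| + `|Im c|)%:C.
Proof.
rewrite normc_def lecR -[leRHS]ger0_norm ?addr_ge0// -sqrtr_sqr ler_wsqrtr//.
by rewrite sqrrD !real_normK ?num_real// lerD2r lerDl mulrn_wge0// mulr_ge0.
Qed.

Lemma le_Im_normc c : `|Im c|%:C <= `|c|.
Proof.
rewrite normc_def lecR -sqrtr_sqr ler_wsqrtr// lerDr; exact: sqr_ge0.
Qed.

Context {T : Type}.
Implicit Types (F : set_system T) (u v : T -> R[i]).

(** Stated through real and imaginary parts so that algebraic operations and
    completeness come from the reals; [ctendsP] and [ctends_cvg] give the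
    equivalent forms with the modulus and with the topology of [R[i]]. *)
Definition ctends F u c :=
  (Re (u x) @[x --> F] --> Re c) /\ (Im (u x) @[x --> F] --> Im c).

Lemma ctendsP F u c {FF : Filter F} :
  ctends F u c <-> forall e : R, 0 < e -> \forall x \near F, `|u x - c| < e%:C.
Proof.
split=> [[/cvgrPdist_lt uRe /cvgrPdist_lt uIm] e e0|ue].
  have e20 : 0 < e / 2 by rewrite divr_gt0.
  near=> x.
  rewrite (le_lt_trans (le_normc_ReIm _))// ltcR ReB ImB.
  rewrite [ltRHS]splitr ltrD// distrC; near: x; [exact: uRe|exact: uIm].
split; apply/cvgrPdist_lt => e e0; near=> x;
  have : `|u x - c| < e%:C by near: x; exact: ue.
- rewrite distrC -ReB -ltcR; exact/le_lt_trans/normc_ge_Re.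
- rewrite distrC -ImB -ltcR; exact/le_lt_trans/le_Im_normc.
Unshelve. all: by end_near. Qed.

Lemma ctends_lt F u c (e : R) : Filter F ->
  ctends F u c -> 0 < e -> \forall x \near F, `|u x - c| < e%:C.
Proof. by move=> FF /ctendsP; apply. Qed.

Lemma ctends_cvg F u c : Filter F ->
  ctends F u c <-> (u x : R[i]^o) @[x --> F] --> (c : R[i]^o).
Proof.
move=> FF; rewrite ctendsP cvgrPdist_lt; split=> uc e e0.
  case: e e0 => a b; rewrite ltcE/= => /andP[/eqP -> a0].
  by near=> x; rewrite distrC; near: x; exact: uc.
near=> x; rewrite distrC; near: x; apply: uc.
by rewrite ltcR.
Unshelve. all: by end_near. Qed.

Lemma ctends_unique F u c d : ProperFilter F ->
  ctends F u c -> ctends F u d -> c = d.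
Proof.
move=> FF [uRe uIm] [vRe vIm].
have := cvg_unique (@norm_hausdorff _ R) uRe vRe.
have := cvg_unique (@norm_hausdorff _ R) uIm vIm.
by case: c d {uRe uIm vRe vIm} => a b [a' b'] /= -> ->.
Qed.

Lemma ctends_cst F c : Filter F -> ctends F (fun=> c) c.
Proof. by move=> FF; split; exact: cvg_cst. Qed.

Lemma ctendsD F u v c d : Filter F ->
  ctends F u c -> ctends F v d -> ctends F (fun x => u x + v x) (c + d).
Proof.
move=> FF [uRe uIm] [vRe vIm]; split.
  by under eq_fun do rewrite ReD; rewrite ReD; exact: cvgD.
by under eq_fun do rewrite ImD; rewrite ImD; exact: cvgD.
Qed.

Lemma ctendsM F u v c d : Filter F ->
  ctends F u c -> ctends F v d -> ctends F (fun x => u x * v x) (c * d).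
Proof.
move=> FF [uRe uIm] [vRe vIm]; split.
  by under eq_fun do rewrite ReM; rewrite ReM; apply: cvgB; exact: cvgM.
by under eq_fun do rewrite ImM; rewrite ImM; apply: cvgD; exact: cvgM.
Qed.

Lemma ctends_conj F u c : Filter F ->
  ctends F u c -> ctends F (fun x => (u x)^*) c^*.
Proof.
have ReJ d : Re d^* = Re d by case: d.
have ImJ d : Im d^* = - Im d by case: d.
move=> FF [uRe uIm]; split.
  by under eq_fun do rewrite ReJ; rewrite ReJ.
by under eq_fun do rewrite ImJ; rewrite ImJ; exact: cvgN.
Qed.

(** Completeness: a function that is uniformly approximated by functions having
    a common limit along all filters of a class has one too. A single filter of
    the class produces the limit, as a Cauchy limit; the approximating functions
    carry it over to the other filters. *)
Lemma ctends_uniform (P : set_system T -> Prop) u :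
    (forall e : R, 0 < e -> exists v c,
      (forall x, `|u x - v x| <= e%:C) /\
      (forall F, ProperFilter F -> P F -> ctends F v c)) ->
  exists c, forall F, ProperFilter F -> P F -> ctends F u c.
Proof.
move=> uv; have [[F0 [FF0 PF0]]|nP] :=
    pselect (exists F, ProperFilter F /\ P F); last first.
  by exists 0 => F FF PF; case: nP; exists F.
have [c uc] : exists c, ctends F0 u c.
  have cauchyW (p : R[i] -> R) : {morph p : x y / x - y} -> (
      forall d, `|p d|%:C <= `|d|) ->
      exists a : R, p (u x) @[x --> F0] --> a.
    move=> pB pd; suff /cauchy_cvgP/cvg_ex[a ?] : cauchy (p (u x) @[x --> F0]).
      by exists a.
    apply: cauchy_exP => e e0.
    have e20 : 0 < e / 2 by rewrite divr_gt0.
    have [v [d [uve vd]]] := uv _ e20.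
    have {}vd := ctends_lt FF0 (vd _ FF0 PF0) e20.
    exists (p d); rewrite /= near_simpl; near=> x.
    rewrite -ball_normE/= -pB -ltcR (le_lt_trans (pd _))//.
    rewrite distrC -(subrK (v x) (u x)) -addrA.
    rewrite (le_lt_trans (ler_normD _ _))// [e]splitr rmorphD ler_ltD//.
    by near: x.
  have [a ua] := cauchyW _ ReB (@normc_ge_Re R).
  have [b ub] := cauchyW _ ImB le_Im_normc.
  by exists (a +i* b).
exists c => F FF PF; apply/ctendsP => e e0.
(* One fifth for each of |u - v| and |v - d|, three fifths for |c - d|. *)
have e50 : 0 < e / 5 by rewrite divr_gt0.
have [v [d [uve vd]]] := uv _ e50.
have uvB x : `|u x - d| <= (e / 5)%:C + `|v x - d|.
  rewrite -(subrK (v x) (u x)) -addrA (le_trans (ler_normD _ _))//.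
  by rewrite lerD2r.
have v0 := ctends_lt FF0 (vd _ FF0 PF0) e50.
have u0 := ctends_lt FF0 uc e50.
have [x0 [vx0 ux0]] := filter_ex (filterI v0 u0).
have cd : `|c - d| < (3 * (e / 5))%:C.
  rewrite -(subrK (u x0) c) -addrA (le_lt_trans (ler_normD _ _))//.
  have -> : 3 * (e / 5) = e / 5 + (e / 5 + e / 5) by lra.
  rewrite !rmorphD ltrD//; first by rewrite distrC.
  by rewrite (le_lt_trans (uvB _))// ler_ltD.
have {}vd := ctends_lt FF (vd _ FF PF) e50.
near=> x; rewrite -(subrK d (u x)) -addrA (le_lt_trans (ler_normD _ _))//.
rewrite [ltRHS](_ : _ = (e / 5)%:C + (e / 5)%:C + (3 * (e / 5))%:C); last first.
  by rewrite -!rmorphD; congr _%:C; lra.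
rewrite ltrD//; last by rewrite distrC.
rewrite (le_lt_trans (uvB _))// ler_ltD//.
by near: x.
Unshelve. all: by end_near. Qed.
End ComplexLimits.

(** * The closed unit ball *)
Section RowVectors.
Context {R : realType}.

Lemma rV_cvg n (T : Type) (F : set_system T) (f : T -> 'rV[R]_n)
    (w : 'rV[R]_n) :
  Filter F -> (forall i, f x 0 i @[x --> F] --> w 0 i) ->
  f x @[x --> F] --> w.
Proof.
move=> FF fw; rewrite [w]row_sum_delta.
under eq_fun do rewrite [f _]row_sum_delta.
apply: cvg_big => [|i _]; last by apply: cvgZ; [exact: fw|exact: cvg_cst].
by move=> ?; exact: add_continuous.
Qed.

Lemma le_rV_norm n (w : 'rV[R]_n) i : `|w 0 i| <= `|w|.
Proof.
rewrite [leRHS]/Num.norm/= mx_normrE.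
exact: (le_bigmax _ (fun ij : 'I_1 * 'I_n => `|w ij.1 ij.2|) (0, i)).
Qed.

(** The image of an ultrafilter under any map into the compact unit ball
    converges: at a cluster point [w], no neighborhood of [w] can have its
    complement in the image filter. *)
Lemma ball_cluster n (T : Type) (F : set_system T) (f : T -> 'rV[R]_n) :
    UltraFilter F -> (forall x, `|f x| <= 1) ->
  exists2 w, `|w| <= 1 & f x @[x --> F] --> w.
Proof.
move=> FU f1; pose B := [set w : 'rV[R]_n | `|w| <= 1].
have cB : compact B.
  apply: bounded_closed_compact.
    by exists 1; split => // M M1 w /= w1; rewrite (le_trans w1)// ltW.
  apply: (closed_comp (f := fun w : 'rV[R]_n => `|w|)
    (D := [set r : R | r <= 1])).
    by move=> w _; exact: norm_continuous.
  exact: closed_le.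
have FB : F (f @^-1` B) by apply: filterS filterT => x _; exact: f1.
have [w [Bw Fw]] := cB (f @ F) _ FB.
exists w => // A wA; have [//|FnA] := in_ultra_setVsetC (f @^-1` A) FU.
have [x [/= ? ?]] := Fw (~` A) A FnA wA.
by [].
Qed.

End RowVectors.

(** * The compactification of a vector space by its half-lines *)
Section Compactification.
Context {R : realType} {E : vectType R}.
Implicit Types (x z : E) (alpha beta : halfline E) (w : 'rV[R]_(\dim {:E})).

Lemma rvK : cancel rv (@of_coord R E).
Proof. exact/rVofK/vbasisP. Qed.

Lemma of_coordK : cancel (@of_coord R E) rv.
Proof. exact/vecofK/vbasisP. Qed.

Lemma of_coordZ (k : R) w : of_coord (k *: w) = k *: of_coord w :> E.
Proof. by rewrite /of_coord linearZ. Qed.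

Lemma rv_eq0 x : (rv x == 0) = (x == 0).
Proof. by rewrite -[x == 0](inj_eq (can_inj rvK)) linear0. Qed.

Lemma hl_ptP alpha : (alpha : set E) (hl_pt alpha).
Proof.
have [a _ aE] := hl_ray alpha.
apply: (@xgetPex _ 0 (alpha : set E)); exists a; rewrite aE.
by exists 1; rewrite /= ?scale1r.
Qed.

Lemma hl_pt_neq0 alpha : hl_pt alpha != 0.
Proof.
have [a a0 aE] := hl_ray alpha.
have := hl_ptP alpha; rewrite aE => -[r /= r0 <-].
by rewrite scaler_eq0 negb_or a0 gt_eqF.
Qed.

Lemma hl_setP alpha x :
  (alpha : set E) x <-> exists2 r : R, 0 < r & x = r *: hl_pt alpha.
Proof.
have [a _ aE] := hl_ray alpha; have := hl_ptP alpha; rewrite aE.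
move=> [r /= r0 ra]; split=> -[s /= s0].
  move=> <-; exists (s / r); first by rewrite divr_gt0.
  by rewrite -ra scalerA divfK// gt_eqF.
by move=> ->; exists (s * r); [exact: mulr_gt0|rewrite -ra scalerA].
Qed.

Lemma halfline_inj alpha beta : (alpha : set E) = beta -> alpha = beta.
Proof.
case: alpha beta => [A Aray] [B Bray] /= AB; move: Aray; rewrite AB => Aray.
by congr HalfLine; exact: Prop_irrelevance.
Qed.

(** A homeomorphism onto the open unit ball that preserves directions. *)
Definition to_ball x : 'rV[R]_(\dim {:E}) := (1 + `|rv x|)^-1 *: rv x.

Lemma norm_to_ball x : `|to_ball x| = `|rv x| / (1 + `|rv x|).
Proof.
by rewrite normrZ mulrC ger0_norm// invr_ge0 addr_ge0.
Qed.

Lemma norm_to_ball_lt1 x : `|to_ball x| < 1.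
Proof. by rewrite norm_to_ball ltr_pdivrMr ?mul1r ?ltrDr// ltr_wpDr. Qed.

Lemma onem_norm_to_ball x : 1 - `|to_ball x| = (1 + `|rv x|)^-1.
Proof.
have d0 : 1 + `|rv x| != 0 by rewrite gt_eqF// ltr_wpDr.
by apply: (mulIf d0); rewrite norm_to_ball mulrBl divfK// mulVf// mul1r addrK.
Qed.

Lemma to_ballK x : (1 - `|to_ball x|)^-1 *: to_ball x = rv x.
Proof.
by rewrite onem_norm_to_ball invrK scalerA mulfV ?scale1r// gt_eqF// ltr_wpDr.
Qed.

Definition dir alpha : 'rV[R]_(\dim {:E}) :=
  `|rv (hl_pt alpha)|^-1 *: rv (hl_pt alpha).

Lemma norm_rv_hl_pt alpha : 0 < `|rv (hl_pt alpha)|.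
Proof. by rewrite normr_gt0 rv_eq0 hl_pt_neq0. Qed.

Lemma norm_dir alpha : `|dir alpha| = 1.
Proof.
have a0 := norm_rv_hl_pt alpha.
by rewrite normrZ ger0_norm ?invr_ge0// mulVf// gt_eqF.
Qed.

Definition bar := (E + halfline E)%type.

(** Realizes [bar E] as the closed unit ball: [ball_of] is a bijection onto it,
    and convergence in [bar E] is convergence of images. *)
Definition ball_of (p : bar) : 'rV[R]_(\dim {:E}) :=
  match p with inl z => to_ball z | inr alpha => dir alpha end.

Lemma hl_dir alpha x :
  (alpha : set E) x <-> x != 0 /\ `|rv x|^-1 *: rv x = dir alpha.
Proof.
have a0 := norm_rv_hl_pt alpha.
split=> [/hl_setP[r r0 ->]|[x0 xdir]].
  split; first by rewrite scaler_eq0 negb_or hl_pt_neq0 gt_eqF.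
  rewrite linearZ/= normrZ invfM scalerA -mulrA mulrCA (gtr0_norm r0).
  by rewrite mulVf ?mulr1// gt_eqF.
have nx0 : 0 < `|rv x| by rewrite normr_gt0 rv_eq0.
apply/hl_setP; exists (`|rv x| / `|rv (hl_pt alpha)|); first exact: divr_gt0.
apply: (can_inj rvK); rewrite linearZ/= -scalerA -/(dir _) -xdir.
by rewrite scalerA mulfV ?scale1r// gt_eqF.
Qed.

Lemma ball_of_inj : injective ball_of.
Proof.
move=> [x|alpha] [y|beta]/= pq.
- by congr inl; apply: (can_inj rvK); rewrite -to_ballK pq to_ballK.
- by have := norm_to_ball_lt1 x; rewrite pq norm_dir ltxx.
- by have := norm_to_ball_lt1 y; rewrite -pq norm_dir ltxx.
- congr inr; apply: halfline_inj; apply/seteqP; split=> x.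
    by move=> /hl_dir[x0 xa]; apply/hl_dir; rewrite -pq.
  by move=> /hl_dir[x0 xa]; apply/hl_dir; rewrite pq.
Qed.

Lemma ball_of_surj w : `|w| <= 1 -> exists p, ball_of p = w.
Proof.
rewrite le_eqVlt => /orP[/eqP w1|w1].
  have a0 : of_coord w != 0 :> E.
    by rewrite -rv_eq0 of_coordK -normr_eq0 w1 oner_eq0.
  pose alpha := HalfLine (ex_intro2 _ _ (of_coord w : E) a0 erefl).
  exists (inr alpha) => /=.
  have /hl_dir[_ <-] : (alpha : set E) (of_coord w).
    by exists 1; rewrite //= scale1r.
  by rewrite of_coordK w1 invr1 scale1r.
exists (inl (of_coord ((1 - `|w|)^-1 *: w))) => /=.
rewrite /to_ball of_coordK normrZ ger0_norm ?invr_ge0 ?subr_ge0 1?ltW//.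
have d0 : 1 - `|w| != 0 by rewrite gt_eqF// subr_gt0.
by rewrite scalerA -invfM mulrDl mul1r mulrAC mulVf// mul1r subrK invr1 scale1r.
Qed.

End Compactification.

Arguments bar {R} E.

(** * Convergence in the compactification *)
Section Tends.
Context {R : realType} {E : vectType R} {T : Type}.
Implicit Types (F : set_system T) (f : T -> E) (z : E) (p q : bar E).

Definition tends F f p := to_ball (f x) @[x --> F] --> ball_of p.

Lemma tends_unique F f p q : ProperFilter F ->
  tends F f p -> tends F f q -> p = q.
Proof.
move=> FF fp fq; apply: ball_of_inj.
apply: (@cvg_unique 'rV[R]_(\dim {:E}) _ (to_ball (f x) @[x --> F])) fp fq.
exact: norm_hausdorff.
Qed.

Lemma tends_ultra F f : UltraFilter F -> exists p, tends F f p.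
Proof.
move=> FU; have [x|w w1 fw] := ball_cluster (f := to_ball \o f) FU.
  exact/ltW/norm_to_ball_lt1.
by have [p pw] := ball_of_surj w1; exists p; rewrite /tends pw.
Qed.

Lemma tends_inl F f z : Filter F ->
  tends F f (inl z) -> rv (f x) @[x --> F] --> rv z.
Proof.
move=> FF fz; under eq_fun do rewrite -to_ballK.
rewrite -[rv z]to_ballK; apply: cvgZ => //; apply: cvgV.
  by rewrite gt_eqF// subr_gt0 norm_to_ball_lt1.
by apply: cvgB; [exact: cvg_cst|exact: cvg_norm].
Qed.

Lemma inl_tends F f z : Filter F ->
  rv (f x) @[x --> F] --> rv z -> tends F f (inl z).
Proof.
move=> FF fz; apply: cvgZ => //; apply: cvgV.
  by rewrite gt_eqF// ltr_wpDr.
by apply: cvgD; [exact: cvg_cst|exact: cvg_norm].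
Qed.

Lemma vcontinuous_tends F f z (u : E -> R[i]) : Filter F ->
  vcontinuous u -> tends F f (inl z) -> ctends F (u \o f) (u z).
Proof.
move=> FF uc /(tends_inl FF) fz; apply/ctends_cvg.
have := cvg_comp _ _ fz (uc (rv z)); rewrite /= rvK.
by apply: cvg_trans; under eq_fun do rewrite /= -[f _]rvK.
Qed.

(** Functions having limits at half-lines are continuous at the boundary of the
    ball. The point [of_coord (g x)] is the multiple of [f x] whose norm is that
    of [a]; it tends to [a], so it enters the open set [C], and being on the
    same half-line as [f x] it puts [f x] in the cone [C0]. Moreover [f x] leaves
    the bounded set [B], as its norm tends to infinity. *)
Lemma lim_halfline_tends F f alpha (u : E -> R[i]) c : Filter F ->
  lim_halfline u alpha c -> tends F f (inr alpha) -> ctends F (u \o f) c.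
Proof.
move=> FF uc fa; apply/ctendsP => e e0.
have [C [Copen [C0 [B [[H C0E] [M [_ BM]] CE]]] [a aa aC] Cu]] := uc e e0.
have [a0 adir] := (hl_dir alpha a).1 aa.
have na0 : 0 < `|rv a| by rewrite normr_gt0 rv_eq0.
have Ca : C a by rewrite -[a]scale1r; exact: aC.
pose g x := (`|rv a| / `|to_ball (f x)|) *: to_ball (f x).
have ga : g x @[x --> F] --> rv a.
  have -> : rv a = (`|rv a| / `|dir alpha|) *: dir alpha.
    by rewrite norm_dir divr1 -adir scalerA mulfV ?scale1r// gt_eqF.
  apply: cvgZ => //; apply: cvgM; first exact: cvg_cst.
  by apply: cvgV; [rewrite norm_dir oner_eq0|exact: cvg_norm].
have nf1 : `|to_ball (f x)| @[x --> F] --> (1 : R).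
  by rewrite -(norm_dir alpha); exact: cvg_norm.
have nC : \forall x \near F, C (of_coord (g x)).
  apply: (ga (of_coord @^-1` C)); apply: open_nbhs_nbhs; split => //.
  by rewrite /preimage/= rvK.
pose M' := Num.max (M + 1) 0.
have M'1 : 0 < 1 + M' by rewrite ltr_wpDr// le_max lexx orbT.
have nM : \forall x \near F, M' / (1 + M') < `|to_ball (f x)|.
  apply: cvgr_gt nf1 _ _.
  by rewrite ltr_pdivrMr// mul1r ltrDr.
near=> x.
(* |to_ball y| = |y| / (1 + |y|) is an increasing function of |y|. *)
have fxM : M' < `|rv (f x)|.
  have : M' / (1 + M') < `|to_ball (f x)| by near: x.
  rewrite norm_to_ball ltr_pdivrMr// mulrAC ltr_pdivlMr ?ltr_wpDr//.
  by lra.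
have fx0 : 0 < `|rv (f x)| by rewrite (le_lt_trans _ fxM)// le_max lexx orbT.
apply: Cu; rewrite CE; split.
  have : C0 (of_coord (g x)).
    have : C (of_coord (g x)) by near: x.
    by rewrite CE => -[].
  rewrite C0E => -[b Hb /hl_setP[r r0 gr]]; exists b => //; apply/hl_setP.
  have k0 : 0 < `|rv a| / `|to_ball (f x)| / (1 + `|rv (f x)|).
    by rewrite !divr_gt0// ?ltr_wpDr// norm_to_ball divr_gt0// ltr_wpDr.
  exists (r / (`|rv a| / `|to_ball (f x)| / (1 + `|rv (f x)|))).
    exact: divr_gt0.
  rewrite mulrC -scalerA -gr /g /to_ball scalerA of_coordZ rvK scalerA.
  by rewrite mulVf ?scale1r// gt_eqF.
have MM' : M < M' by rewrite lt_max ltrDl ltr01.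
move=> Bf; have := BM M' MM' (rv (f x)); rewrite /preimage/= rvK.
by move=> /(_ Bf); rewrite leNgt fxM.
Unshelve. all: by end_near. Qed.

End Tends.

(** * Functions separating the points of the compactification *)
Section BallCoordinates.
Context {R : realType} {E : vectType R}.
Implicit Types (alpha : halfline E) (x z : E).

(** For [r > 0] the image of [r a + z] in the ball is
    [(a + z / r) / (1 / r + |a + z / r|)], which tends to [a / |a|]. *)
Lemma ray_tends alpha z :
  tends (+oo%R : set_system R) (fun r => r *: hl_pt alpha + z) (inr alpha).
Proof.
have vr0 : r^-1 @[r --> +oo%R] --> (0 : R).
  by apply/gtr0_cvgV0 => //; exact: nbhs_pinfty_gt.
set a := rv (hl_pt alpha).
have h : (a + r^-1 *: rv z) @[r --> +oo%R] --> a.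
  suff : (a + r^-1 *: rv z) @[r --> +oo%R] --> a + 0 *: rv z.
    by rewrite scale0r addr0.
  by apply: cvgD; [exact: cvg_cst|apply: cvgZ => //; exact: cvg_cst].
have : (r^-1 + `|a + r^-1 *: rv z|)^-1 *: (a + r^-1 *: rv z) @[r --> +oo%R]
    --> dir alpha.
  apply: cvgZ => //; apply: cvgV; first by rewrite gt_eqF// norm_rv_hl_pt.
  suff : (r^-1 + `|a + r^-1 *: rv z|) @[r --> +oo%R] --> 0 + `|a|.
    by rewrite add0r.
  by apply: cvgD => //; exact: cvg_norm.
apply: cvg_trans; apply: near_eq_cvg; near=> r.
have r0 : 0 < r by near: r; exact: nbhs_pinfty_gt.
have rE : rv (r *: hl_pt alpha + z) = r *: (a + r^-1 *: rv z).
  by rewrite linearD linearZ scalerDr scalerA mulfV ?scale1r// gt_eqF.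
rewrite /to_ball rE normrZ (gtr0_norm r0) [in RHS]scalerA; congr (_ *: _).
rewrite -[r in RHS]invrK -invfM invrK mulrDl mul1r.
by rewrite [r * _]mulrC mulfK// gt_eqF.
Unshelve. all: by end_near. Qed.

Lemma to_ball_continuous :
  continuous (fun w => to_ball (of_coord w : E) : 'rV[R]_(\dim {:E})).
Proof.
rewrite /to_ball; under eq_fun do rewrite of_coordK.
move=> w; apply: (cvgZ (F := nbhs w)); last exact: cvg_id.
apply: cvgV; first by rewrite gt_eqF// ltr_wpDr.
by apply: cvgD; [exact: cvg_cst|exact: norm_continuous].
Qed.

(** For small [d] and large [M], such cones are mapped close to [dir alpha] by
    [to_ball] ([dist_to_ball_dir]): they test its limit at [alpha]. *)
Lemma near_dir_cone alpha (d : R) (M : R) : 0 < d -> 0 <= M ->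
  let C := [set x | M < `|rv x| /\ `| `|rv x|^-1 *: rv x - dir alpha| < d] in
  [/\ vopen C, truncated_cone C & eventually_in alpha C].
Proof.
move=> d0 M0 /=; split.
- rewrite /vopen openE => w /=.
  rewrite of_coordK => -[Mw wd].
  have w0 : 0 < `|w| by exact: le_lt_trans Mw.
  have wc : `|v|^-1 *: v @[v --> w] --> `|w|^-1 *: w.
    apply: (cvgZ (F := nbhs w)); last exact: cvg_id.
    by apply: cvgV; [rewrite gt_eqF|exact: norm_continuous].
  have wc' : `| `|v|^-1 *: v - dir alpha| @[v --> w] -->
      `| `|w|^-1 *: w - dir alpha|.
    apply: (cvg_norm (F := nbhs w)).
    apply: (cvgB (F := nbhs w)); first exact: wc.
    exact: cvg_cst.
  have h1 : \forall v \near w, M < `|v|.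
    by apply: (@cvgr_gt _ _ (nbhs w) _ _ `|w|) Mw; exact: norm_continuous.
  have h2 := @cvgr_lt _ _ (nbhs w) _ _ _ wc' _ wd.
  rewrite /interior/=; near=> v; rewrite /= of_coordK.
  by split; near: v; [exact: h1|exact: h2].
- exists [set x | x != 0 /\ `| `|rv x|^-1 *: rv x - dir alpha| < d].
  exists [set x | `|rv x| <= M]; split.
  + exists [set beta : halfline E | `|dir beta - dir alpha| < d].
    apply/seteqP; split=> x /=.
      move=> [x0 xd]; pose beta := HalfLine (ex_intro2 _ _ x x0 erefl).
      have bx : (beta : set E) x by exists 1; rewrite //= scale1r.
      by exists beta => //=; have [_ <-] := (hl_dir beta x).1 bx.
    by move=> [beta /= bd /hl_dir[x0 xb]]; rewrite xb.
  + exists M; split; first exact: num_real.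
    by move=> N MN w /=; rewrite of_coordK => /le_trans; apply; exact: ltW.
  + apply/seteqP; split=> x /=.
      move=> [Mx xd]; split; last by apply/negP; rewrite -ltNge.
      by split=> //; rewrite -rv_eq0 -normr_gt0; exact: le_lt_trans Mx.
    by move=> [[_ xd] /negP]; rewrite -ltNge.
- have a0 := norm_rv_hl_pt alpha.
  pose k := (M + 1) / `|rv (hl_pt alpha)|.
  have k0 : 0 < k by rewrite divr_gt0// ltr_wpDl.
  exists (k *: hl_pt alpha); first by apply/hl_setP; exists k.
  move=> l l1; have l0 : 0 < l by exact: lt_le_trans l1.
  have : (alpha : set E) (l *: (k *: hl_pt alpha)).
    by apply/hl_setP; exists (l * k); rewrite ?scalerA// mulr_gt0.
  move=> /hl_dir[_ ldir]; rewrite /= ldir subrr normr0; split => //.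
  rewrite scalerA linearZ normrZ (gtr0_norm (mulr_gt0 l0 k0)) -mulrA.
  rewrite divfK ?gt_eqF//.
  by rewrite (@lt_le_trans _ _ (M + 1)) ?ltrDl// ler_peMl// addr_ge0.
Unshelve. all: by end_near. Qed.

Lemma dist_to_ball_dir x (w : 'rV[R]_(\dim {:E})) (M : R) :
    0 < M -> M < `|rv x| ->
  `|to_ball x - w| <= M^-1 + `| `|rv x|^-1 *: rv x - w|.
Proof.
move=> M0 Mx; have x0 : 0 < `|rv x| by exact: lt_trans Mx.
rewrite -(subrK (`|rv x|^-1 *: rv x) (to_ball x)) -addrA.
rewrite (le_trans (ler_normD _ _))// lerD2r.
rewrite /to_ball -scalerBl normrZ distrC ger0_norm; last first.
  by rewrite subr_ge0 lef_pV2 ?posrE ?ltr_wpDl// lerDr.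
rewrite mulrBl mulVf ?gt_eqF// mulrC -norm_to_ball onem_norm_to_ball.
by rewrite lef_pV2 ?posrE ?ltr_wpDl// (le_trans (ltW Mx))// lerDr.
Qed.

(** The embedding extends continuously to [bar E] by [ball_of], so its coordinates
    have limits at half-lines; together they determine a point of [bar E]. *)
Lemma to_ball_Cbar i :
  Cbar E (fun x => (to_ball x 0 i)%:C).
Proof.
split=> [w|alpha].
  have : ctends (nbhs w) (fun v => (to_ball (of_coord v : E) 0 i)%:C)
      (to_ball (of_coord w : E) 0 i)%:C.
    split; last exact: cvg_cst.
    have c0 : continuous ((fun v : 'rV[R]_(\dim {:E}) => v 0 i) \o
        (fun v => to_ball (of_coord v : E))).
      move=> v; apply: continuous_comp; first exact: to_ball_continuous.
      exact: coord_continuous.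
    exact: c0.
  by move=> /ctends_cvg.
exists (dir alpha 0 i)%:C => e e0.
have e20 : 0 < e / 2 by rewrite divr_gt0.
have M0 : 0 < (e / 2)^-1 by rewrite invr_gt0.
have [Co Ct Ce] := near_dir_cone alpha e20 (ltW M0).
eexists; split; [exact: Co|exact: Ct|exact: Ce|].
move=> x /= [Mx xd]; rewrite -rmorphB normc_def/= expr0n/= addr0 sqrtr_sqr ltcR.
have := dist_to_ball_dir (dir alpha) M0 Mx.
rewrite invrK => h.
apply: (@le_lt_trans _ _ `|to_ball x - dir alpha|).
  have -> : to_ball x 0 i - dir alpha 0 i = (to_ball x - dir alpha) 0 i.
    by rewrite !mxE.
  exact: le_rV_norm.
by rewrite (le_lt_trans h)// [ltRHS]splitr ltrD2l.
Qed.

End BallCoordinates.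

Section Separation.
Context {R : realType} {E : vectType R} {T : Type}.
Implicit Types (F G : set_system T) (f : T -> E).

(** Convergence in [bar E] can be tested on functions of [Cbar E]. *)
Lemma tends_separated F G f p : Filter F -> Filter G ->
  (forall u c, Cbar E u -> ctends F (u \o f) c -> ctends G (u \o f) c) ->
  tends F f p -> tends G f p.
Proof.
move=> FF GF FG fp; apply: rV_cvg => i.
have /= [+ _] : ctends G (fun x => (to_ball (f x) 0 i)%:C) (ball_of p 0 i)%:C.
  apply: (FG _ _ (to_ball_Cbar i)).
  split; last exact: cvg_cst.
  have ci : {for ball_of p, continuous (fun v : 'rV[R]_(\dim {:E}) => v 0 i)}.
    exact: coord_continuous.
  exact: (cvg_comp _ _ fp ci).
by [].
Qed.

End Separation.

(** * Linear maps and the compactification *)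
Section LinearImages.
Context {R : realType} {E E' : vectType R} (L : {linear E -> E'}).

Definition coord_lin (w : 'rV[R]_(\dim {:E})) : 'rV[R]_(\dim {:E'}) :=
  rv (L (of_coord w)).

Lemma coord_linZ k w : coord_lin (k *: w) = k *: coord_lin w.
Proof. by rewrite /coord_lin of_coordZ !linearZ. Qed.

Lemma coord_lin_cvg (T : Type) (F : set_system T)
    (f : T -> 'rV[R]_(\dim {:E})) w : Filter F ->
  f x @[x --> F] --> w -> coord_lin (f x) @[x --> F] --> coord_lin w.
Proof.
move=> FF fw.
have cE v : coord_lin v = \sum_i v 0 i *: rv (L (vbasis fullv)`_i).
  rewrite /coord_lin /of_coord /vecof !linear_sum/=.
  by apply: eq_bigr => i _; rewrite !linearZ.
rewrite cE; under eq_fun do rewrite cE.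
apply: cvg_big => [|i _]; first exact: add_continuous.
apply: cvgZ; last exact: cvg_cst.
have ci : {for w, continuous (fun v : 'rV[R]_(\dim {:E}) => v 0 i)}.
  exact: coord_continuous.
exact: (cvg_comp _ _ fw ci).
Qed.

(** In the ball, [L] reads [y |-> L y / (1 - |y| + |L y|)]. This formula still
    makes sense, and is continuous, at points [y] of the unit sphere such that
    [L y != 0]: hence [L] extends continuously to every half-line that it does
    not kill. *)
Lemma to_ball_lin x : let y := to_ball x in
  to_ball (L x) = (1 - `|y| + `|coord_lin y|)^-1 *: coord_lin y.
Proof.
have n0 : 0 < 1 + `|rv x| by rewrite ltr_wpDr.
have cE : coord_lin (rv x) = rv (L x) by rewrite /coord_lin rvK.
rewrite /= onem_norm_to_ball /to_ball coord_linZ cE normrZ.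
rewrite gtr0_norm ?invr_gt0//.
rewrite scalerA -invfM -[X in (X + _) * _]mulr1 -mulrDr.
by rewrite [_ * (1 + `|rv x|)]mulrC mulVKf// gt_eqF.
Qed.

Lemma tends_lin_inl (T : Type) (F : set_system T) (f : T -> E) z : Filter F ->
  tends F f (inl z) -> tends F (L \o f) (inl (L z)).
Proof.
move=> FF /(tends_inl FF) fz; apply: inl_tends.
have := coord_lin_cvg FF fz; rewrite /coord_lin rvK.
by under eq_fun do rewrite rvK.
Qed.

Lemma tends_lin_inr alpha : L (hl_pt alpha) != 0 -> exists q,
  forall (T : Type) (F : set_system T) (f : T -> E), Filter F ->
    tends F f (inr alpha) -> tends F (L \o f) q.
Proof.
move=> La0; have La : coord_lin (dir alpha) != 0.
  rewrite coord_linZ /coord_lin rvK scaler_eq0 negb_or rv_eq0 La0 andbT.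
  by rewrite invr_eq0 gt_eqF// norm_rv_hl_pt.
pose w := `|coord_lin (dir alpha)|^-1 *: coord_lin (dir alpha).
have [q qw] : exists q : bar E', ball_of q = w.
  apply: ball_of_surj; rewrite normrZ ger0_norm ?invr_ge0// mulVf//.
  by rewrite normr_eq0.
exists q => T F f FF fa; rewrite /tends qw /=.
under eq_fun do rewrite to_ball_lin/=.
have cfa := coord_lin_cvg FF fa.
apply: cvgZ => //; apply: cvgV; first by rewrite normr_eq0.
rewrite -[X in _ --> X]add0r (_ : 0 = 1 - `|dir alpha|); last first.
  by rewrite norm_dir subrr.
apply: cvgD; last exact: cvg_norm.
by apply: cvgB; [exact: cvg_cst|exact: cvg_norm].
Qed.

End LinearImages.

(** * Quotient maps *)
Section QuotientMaps.
Context {R : realType} {X : vectType R}.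
Implicit Types Y W : {vspace X}.

Lemma prvE0 Y x : (prv Y x == 0) = (x \in Y).
Proof.
rewrite -(linear0 (prv Y)); apply/eqP/idP => [/prv_eqP|xY]; rewrite ?subr0//.
by apply/prv_eqP; rewrite subr0.
Qed.

Definition quot_map Y W (sYW : (Y <= W)%VS) (z : quotv Y) : quotv W :=
  prv W (repr z).

Section Inclusion.
Context {Y W : {vspace X}} (sYW : (Y <= W)%VS).

Lemma quot_map_prv x : quot_map sYW (prv Y x) = prv W x.
Proof. by apply/prv_eqP/(subvP sYW)/prv_eqP; rewrite prv_repr. Qed.

Lemma quot_map_linear : linear (quot_map sYW).
Proof.
move=> k z t; rewrite -[z]prv_repr -[t]prv_repr -linearP !quot_map_prv.
exact: linearP.
Qed.

HB.instance Definition _ := GRing.isSemilinear.Build R (quotv Y) (quotv W) _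
  (quot_map sYW) (GRing.semilinear_linear quot_map_linear).

End Inclusion.

Lemma mem_preline Y (alpha : halfline (quotv Y)) x :
  (x \in preline alpha) = (prv Y x \in hl_line alpha).
Proof. by rewrite -memv_preim lfunE. Qed.

Lemma sub_preline Y (alpha : halfline (quotv Y)) : (Y <= preline alpha)%VS.
Proof.
apply/subvP => x xY; rewrite mem_preline.
by rewrite (eqP (_ : prv Y x == 0)) ?mem0v// prvE0.
Qed.

(** Each half-line of a sequence uses up one dimension of [X]; this bounds the
    length of the sequence followed by an ultrafilter. *)
Lemma dim_preline Y (alpha : halfline (quotv Y)) :
  (\dim Y < \dim (preline alpha))%N.
Proof.
rewrite ltnNge; apply/negP => dimY; have := sub_preline alpha.
move=> /dimv_leqif_eq/geq_leqif; rewrite dimY => /esym/eqP YE.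
have : repr (hl_pt alpha) \in Y.
  have YP x : (x \in Y) = (x \in preline alpha) by rewrite -YE.
  by rewrite YP mem_preline prv_repr memv_line.
by rewrite -prvE0 prv_repr (negPf (hl_pt_neq0 alpha)).
Qed.

End QuotientMaps.

(** * Convergence of the functions in the algebra *)
Section Convergence.
Context {R : realType} {X : vectType R}.
Implicit Types (Y W : {vspace X}) (F : set_system X) (u : X -> R[i]).

Definition convergent (P : set_system X -> Prop) : set (X -> R[i]) :=
  [set u | exists c, forall F, ProperFilter F -> P F -> ctends F u c].

Lemma convergent_closed P : closed_subalgebra (convergent P).
Proof.
split=> [u v [c uc] [d vd]|k u [c uc]|u v [c uc] [d vd]|u uP].
- by exists (c + d) => F FF PF; apply: ctendsD; [exact: uc|exact: vd].
- exists (k * c) => F FF PF; apply: ctendsM; last exact: uc.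
  exact: ctends_cst.
- by exists (c * d) => F FF PF; apply: ctendsM; [exact: uc|exact: vd].
- apply: ctends_uniform => e /uP[v [c vc] uv]; exists v, c; split=> // x.
Qed.

Lemma Cbar_tends (E : vectType R) v (q : bar E) : Cbar E v ->
  exists c, forall (T : Type) (F : set_system T) (f : T -> E), Filter F ->
    tends F f q -> ctends F (v \o f) c.
Proof.
move=> [vc vl]; case: q => [z|alpha].
  by exists (v z) => T F f FF; exact: vcontinuous_tends.
by have [c vca] := vl alpha; exists c => T F f FF; exact: lim_halfline_tends.
Qed.

(** The functions having one common limit along all filters of a class form a
    closed subalgebra, so it suffices that the generators belong to it. *)
Lemma calE_convergent P :
    (forall W, exists q,
      forall F, ProperFilter F -> P F -> tends F (prv W) q) ->
  @calE R X `<=` convergent P.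
Proof.
move=> PW; apply: smallest_sub; first exact: convergent_closed.
move=> u [W _ [v vC <-]].
have [q qP] := PW W; have [c vc] := Cbar_tends q vC.
by exists c => F FF PF; apply: vc; exact: qP.
Qed.

Lemma calE_ultra F u : UltraFilter F -> calE u -> exists c, ctends F u c.
Proof.
move=> FU Xu; have [|c uc] := @calE_convergent (eq F) _ _ Xu.
  move=> W; have [q Fq] := tends_ultra (prv W) FU.
  by exists q => _ _ <-.
by exists c; apply: uc.
Qed.

End Convergence.

(** * Filters converging to an element of Omega *)
Section Sequences.
Context {R : realType} {X : vectType R}.
Implicit Types (Y W : {vspace X}) (F : set_system X) (u : X -> R[i]).

Fixpoint follows F Y (s : hlseq Y) : Prop :=
  match s with
  | hlnil => True
  | hlcons Y0 s0 alpha => follows F s0 /\ tends F (prv Y0) (inr alpha)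
  end.

Definition converges_to F (p : Omega X) : Prop :=
  follows F (projT2 p).2 /\ tends F (prv (projT1 p)) (inl (projT2 p).1).

(** Take the last term [alpha] of the shortest initial segment of [s] that spans
    a space not contained in [W]. The space spanned before [alpha] is contained
    in [W], and [alpha] does not vanish in the quotient by [W]. *)
Lemma follows_tends Y (s : hlseq Y) W : ~~ (Y <= W)%VS ->
  exists q, forall F, Filter F -> follows F s -> tends F (prv W) q.
Proof.
elim: s => [|Y0 s0 IH alpha nYW]; first by rewrite sub0v.
have [sY0W|/IH[q Fq]] := boolP (Y0 <= W)%VS; last first.
  by exists q => F FF /= [/Fq + _]; apply.
have qE : quot_map sY0W \o prv Y0 = prv W.
  by apply/funext => x; exact: quot_map_prv.
have [|q Fq] := @tends_lin_inr R _ _ (quot_map sY0W) alpha.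
  apply: contra nYW => /eqP La0; apply/subvP => x; rewrite mem_preline.
  move=> /vlineP[k xk]; rewrite -prvE0 -(quot_map_prv sY0W) xk linearZ/= La0.
  by rewrite scaler0.
by exists q => F FF /= [_ Fa]; rewrite -qE; exact: Fq.
Qed.

Lemma converges_to_tends p W :
  exists q, forall F, Filter F -> converges_to F p -> tends F (prv W) q.
Proof.
case: p => Y [z s]; rewrite /converges_to/=.
have [sYW|/(follows_tends s)[q Fq]] := boolP (Y <= W)%VS; last first.
  by exists q => F FF [sF _]; exact: Fq.
have qE : quot_map sYW \o prv Y = prv W.
  by apply/funext => x; exact: quot_map_prv.
exists (inl (quot_map sYW z)) => F FF [_ Fz]; rewrite -qE; exact: tends_lin_inl.
Qed.

Lemma calE_converges_to p u : calE u ->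
  exists c, forall F, ProperFilter F -> converges_to F p -> ctends F u c.
Proof.
apply: calE_convergent => W; have [q Fq] := converges_to_tends p W.
by exists q => F FF; exact: Fq.
Qed.

(** The filter such that a limit along it is the limit, as [r] tends to infinity,
    of the limits along [G r]. *)
Definition nested (G : R -> set_system X) : set_system X :=
  [set A : set X | \forall r \near +oo%R, G r A].

#[local] Instance nested_proper G :
  (forall r, ProperFilter (G r)) -> ProperFilter (nested G).
Proof.
move=> GF; apply: Build_ProperFilter.
  rewrite /nested/= => n0; near (+oo%R : set_system R) => r.
  by apply: (filter_not_empty (G r)); near: r.
split; rewrite /nested/=.
- by near=> r; exact: filterT.
- by move=> A B /= nA nB; near=> r; apply: filterI; near: r.
- by move=> A B AB /= nA; near=> r; apply: (filterS AB); near: r.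
Unshelve. all: by end_near. Qed.

(** The filter of the iterated limit [tau_seq s _ z]: the innermost limit, which
    is taken in [X] itself, belongs to the first half-line of [s]. *)
Fixpoint iterated Y (s : hlseq Y) : quotv Y -> set_system X :=
  match s with
  | hlnil => fun z => principal_filter (repr z)
  | hlcons Y0 s0 alpha => fun z =>
      nested (fun r => iterated s0 (r *: hl_pt alpha + prv Y0 (repr z)))
  end.

#[local] Instance iterated_proper Y (s : hlseq Y) z :
  ProperFilter (iterated s z).
Proof.
elim: s z => [|Y0 s0 IH alpha] z; first exact: principal_filter_proper.
by apply: nested_proper => r; exact: IH.
Qed.

(** Convergence along each [G r] to [w r], and of [w r] to [q], gives convergence
    along the nested filter without any uniformity in [r]. *)
Lemma tends_nested (G : R -> set_system X) (E : vectType R) (f : X -> E)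
    (w : R -> bar E) q :
    (forall r, Filter (G r)) ->
    (forall r, tends (G r) f (w r)) ->
    ball_of (w r) @[r --> +oo%R] --> ball_of q ->
  tends (nested G) f q.
Proof.
move=> GF Gw wq A /nbhs_ballP[e /= e0 Ae].
have e20 : 0 < e / 2 by rewrite divr_gt0.
have /cvgrPdist_lt/(_ _ e20) wqe := wq.
rewrite /nested/= /nbhs/=; near=> r.
have /cvgrPdist_lt/(_ _ e20) := Gw r.
apply: filterS => x xw; apply: Ae; rewrite -ball_normE/=.
rewrite -(subrK (ball_of (w r)) (ball_of q)) -addrA.
rewrite (le_lt_trans (ler_normD _ _))// [e]splitr ltrD//.
near: r; exact: wqe.
Unshelve. all: by end_near. Qed.

Lemma follows_nested (G : R -> set_system X) Y (s : hlseq Y) :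
    (forall r, Filter (G r)) -> (forall r, follows (G r) s) ->
  follows (nested G) s.
Proof.
move=> GF; elim: s => //= Y0 s0 IH alpha Gs; split.
  by apply: IH => r; have [] := Gs r.
apply: (@tends_nested _ _ _ (fun=> inr alpha)).
  by move=> r; have [] := Gs r.
exact: cvg_cst.
Qed.

(** In the quotient by the last line, [r *: hl_pt alpha] vanishes, so the points
    [r *: hl_pt alpha + z0] all have the same image [z]; in the quotient before,
    they tend to [alpha]. *)
Lemma iterated_converges Y (s : hlseq Y) z :
  converges_to (iterated s z) (existT _ Y (z, s)).
Proof.
rewrite /converges_to/=; elim: s z => [|Y0 s0 IH alpha] z /=; split => //.
- by move=> A /nbhs_singleton Az; apply/principal_filterP; rewrite /= prv_repr.
- split.
    apply: follows_nested => r.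
    by have [] := IH (r *: hl_pt alpha + prv Y0 (repr z)).
  apply: (@tends_nested _ _ _
    (fun r => inl (r *: hl_pt alpha + prv Y0 (repr z)))).
    by move=> r; have [] := IH (r *: hl_pt alpha + prv Y0 (repr z)).
  exact: ray_tends.
- pose L : {linear quotv Y0 -> quotv _} := quot_map (sub_preline alpha).
  have qE : L \o prv Y0 = prv (linfun (prv Y0) @^-1: hl_line alpha)%VS.
    by apply/funext => x; exact: quot_map_prv.
  apply: (@tends_nested _ _ _ (fun=> inl z)); last exact: cvg_cst.
  move=> r; rewrite -qE.
  have zE : z = L (r *: hl_pt alpha + prv Y0 (repr z)).
    rewrite linearD linearZ/= [L (prv _ _)]quot_map_prv prv_repr.
    rewrite [L _](_ : _ = 0) ?scaler0 ?add0r//.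
    apply/eqP; rewrite /L -[hl_pt alpha]prv_repr /= quot_map_prv prvE0.
    rewrite mem_preline prv_repr.
    exact: memv_line.
  rewrite [in inl z]zE; apply: tends_lin_inl.
  by have [] := IH (r *: hl_pt alpha + prv Y0 (repr z)).
Qed.

(** The existence of the limit along the iterated filter is known beforehand,
    from [calE_converges_to]; this is what makes all the partial limits in
    [tau_seq] exist. *)
Lemma tau_seq_iterated Y (s : hlseq Y) z u : calE u ->
  ctends (iterated s z) u (tau_seq s u z).
Proof.
move=> Eu; elim: s z => [|Y0 s0 IH alpha] z.
  apply/ctendsP => e e0; apply/principal_filterP.
  by rewrite /= subrr normr0 ltcR.
have [c uc] := calE_converges_to (existT _ _ (z, hlcons s0 alpha)) Eu.
have {}uc := uc _ (iterated_proper _ _) (iterated_converges _ _).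
suff -> : tau_seq (hlcons s0 alpha) u z = c by [].
rewrite /= /tau; apply: (@cvg_lim R[i]^o); first exact: norm_hausdorff.
apply/ctends_cvg/ctendsP => e e0.
have e20 : 0 < e / 2 by rewrite divr_gt0.
have nu : \forall r \near +oo%R,
    iterated s0 (r *: hl_pt alpha + prv Y0 (repr z))
      [set x | `|u x - c| < (e / 2)%:C].
  exact: (ctends_lt (iterated_proper (hlcons s0 alpha) z) uc e20).
near=> r.
have rc : iterated s0 (r *: hl_pt alpha + prv Y0 (repr z))
  [set x | `|u x - c| < (e / 2)%:C] by near: r.
have tc := ctends_lt (iterated_proper _ _)
  (IH (r *: hl_pt alpha + prv Y0 (repr z))) e20.
have [x [xc xt]] := filter_ex (filterI rc tc).
rewrite -(subrK (u x) (tau_seq _ _ _)) -addrA (le_lt_trans (ler_normD _ _))//.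
by rewrite [e]splitr rmorphD ltrD// distrC.
Unshelve. all: by end_near. Qed.

(** By compactness an ultrafilter tends, in each quotient, to a point or to a
    half-line, and a half-line extends the sequence. The induction is on a bound
    [k] for the dimension of the current quotient. *)
Lemma ultra_converges F : UltraFilter F -> exists p, converges_to F p.
Proof.
move=> FU; suff H k Y (s : hlseq Y) : (\dim {:X} <= \dim Y + k)%N ->
    follows F s -> exists p, converges_to F p.
  by apply: (H (\dim {:X}) _ (hlnil X)) => //; rewrite dimv0.
elim: k Y s => [|k IH] Y s dY sF; have [[z|alpha] Fp] := tends_ultra (prv Y) FU.
- by exists (existT _ Y (z, s)).
- have := dim_preline alpha; rewrite ltnNge (leq_trans (dimvS (subvf _)))//.
  by rewrite -[leqRHS]addn0.
- by exists (existT _ Y (z, s)).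
- apply: (IH _ (hlcons s alpha)) => //.
  by rewrite (leq_trans dY)// addnS -addSn leq_add2r dim_preline.
Qed.

End Sequences.

(** * Stability properties of the algebra *)
Section CalEAlgebra.
Context {R : realType} {X : vectType R}.
Implicit Types (u v : X -> R[i]).

Lemma dist_conjc (c d : R[i]) : `|c^* - d^*| = `|c - d|.
Proof. by rewrite -rmorphB normcJ. Qed.

Lemma Cbar_conj (E : vectType R) (u : E -> R[i]) :
  Cbar E u -> Cbar E (fun x => (u x)^*).
Proof.
move=> [uc ul]; split=> [w|alpha].
  have uw : ctends (nbhs w) (u \o of_coord) (u (of_coord w)).
    by apply/ctends_cvg; exact: uc.
  have : ctends (nbhs w) (fun x => (u (of_coord x))^*) (u (of_coord w))^*.
    exact: ctends_conj.
  by move=> /ctends_cvg.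
have [c uca] := ul alpha; exists c^* => e /uca[C [Co Ct Ce uC]].
by exists C; split=> // x /uC; rewrite dist_conjc.
Qed.

Lemma calE_conj u : calE u -> calE (fun x => (u x)^*).
Proof.
have [ED EZ EM Es] := @calE_closed R X.
move: u; apply: (@smallest_sub _ _ _ [set u | calE (fun x => (u x)^*)]).
  split=> [u v|k u|u v|u us] /=.
  - by move=> /ED/[apply]; congr calE; apply/funext => x; rewrite [RHS]rmorphD.
  - by move=> /(EZ k^*); congr calE; apply/funext => x; rewrite [RHS]rmorphM.
  - by move=> /EM/[apply]; congr calE; apply/funext => x; rewrite [RHS]rmorphM.
  - apply: Es => e /us[v /= Ev uv]; exists (fun x => (v x)^*) => // x.
    by rewrite dist_conjc.
move=> _ [W _ [v vC <-]]; apply: sub_gen_smallest; exists W => //.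
by exists (fun x => (v x)^*) => //; exact: Cbar_conj.
Qed.

Lemma calE_cst (c : R[i]) : @calE R X (fun=> c).
Proof.
have [_ EZ _ _] := @calE_closed R X.
have := EZ c _ (@calE1 R X); congr calE; apply/funext => x.
exact: mulr1.
Qed.

(** If [u] were unbounded, [|u|] would tend to infinity along some ultrafilter,
    along which [u] has a finite limit. *)
Lemma calE_bounded u : calE u -> exists M : R, forall x, `|u x| <= M%:C.
Proof.
move=> Eu; apply: contrapT => nM.
pose B (M : R) := [set x | M%:C < `|u x|].
have BM M : B M !=set0.
  apply: contrapT => BM0; apply: nM; exists M => x.
  rewrite real_leNgt ?normr_real//; last by apply/complex_realP; exists M.
  by apply/negP => Mx; apply: BM0; exists x.
have FP : ProperFilter (filter_from [set: R] B).
  apply: filter_from_proper => //; apply: filter_from_filter; first by exists 0.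
  move=> M N _ _; exists (Num.max M N) => // x Mx.
  by split; apply: le_lt_trans Mx; rewrite lecR le_max lexx ?orbT.
have [G [GU FG]] := ultraFilterLemma FP.
have [c uc] := calE_ultra GU Eu.
have GP := @ultra_proper _ _ GU.
have [a ca] : exists a : R, `|c| = a%:C by rewrite normc_def; eexists.
have GB : G (B (a + 1)) by apply: FG; exists (a + 1).
have [x [xB xc]] := filter_ex (filterI GB (ctends_lt GP uc ltr01)).
suff /(lt_trans xB) : `|u x| < (a + 1)%:C by rewrite ltxx.
rewrite -(subrK c (u x)) (le_lt_trans (ler_normD _ _))//.
by rewrite ca addrC rmorphD ltrD2l.
Qed.

(** The Neumann series: if [d <= g <= M] and [q = 1 - g / M], then
    [0 <= q <= 1 - d / M < 1] and the partial sums [(1 - q ^ n) / g] of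
    [1 / g = (1 + q + q ^ 2 + ..) / M] converge uniformly. *)
Lemma calE_inv (g : X -> R) (d : R) : 0 < d -> (forall x, d <= g x) ->
  calE (fun x => (g x)%:C) -> calE (fun x => (g x)^-1%:C).
Proof.
have [ED EZ EM Es] := @calE_closed R X.
move=> d0 dg Eg; have [M gM] := calE_bounded Eg.
have {}gM x : g x <= M.
  have := gM x; rewrite normc_def lecR/= expr0n/= addr0 sqrtr_sqr.
  by apply/le_trans/ler_norm.
have g0 x : 0 < g x by exact: lt_le_trans (dg x).
have M0 : 0 < M by exact: lt_le_trans (gM 0).
pose q x := 1 - g x / M; pose q0 := 1 - d / M.
have q_ge0 x : 0 <= q x by rewrite subr_ge0 ler_pdivrMr// mul1r.
have qq0 x : q x <= q0 by rewrite lerD2l lerN2 ler_pM2r ?invr_gt0.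
have q01 : `|q0| < 1.
  by rewrite ger0_norm ?(le_trans (q_ge0 0))// ltrBlDr ltrDl divr_gt0.
pose v n x := (((1 - q x ^+ n) / g x)%:C : R[i]).
have Eq : calE (fun x => (q x)%:C).
  have := ED _ _ (calE_cst 1) (EZ (- M^-1)%:C _ Eg); congr calE.
  apply/funext => x; rewrite /q mulrC -mulNr rmorphD rmorphM//.
have Ev n : calE (v n).
  elim: n => [|n IH].
    have := calE_cst 0; congr calE; apply/funext => x.
    by rewrite /v expr0 subrr mul0r.
  have := ED _ _ (calE_cst M^-1%:C) (EM _ _ Eq IH); congr calE.
  apply/funext => x.
  transitivity ((M^-1 + q x * ((1 - q x ^+ n) / g x))%:C).
    by rewrite rmorphD rmorphM.
  congr (_%:C); rewrite exprS /q; field.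
  by rewrite !gt_eqF.
apply: Es => e e0.
have /cvgrPdist_lt/(_ (e * d)) := cvg_expr q01.
move=> /(_ (mulr_gt0 e0 d0))[n _ /(_ n)/= /(_ (leqnn n))].
rewrite sub0r normrN => qe; exists (v n) => // x.
rewrite /v -rmorphB.
have -> : (g x)^-1 - (1 - q x ^+ n) / g x = q x ^+ n / g x.
  by rewrite mulrBl mul1r opprB addrC subrK.
rewrite normc_def lecR/= expr0n/= addr0 sqrtr_sqr ger0_norm; last first.
  by rewrite divr_ge0 ?exprn_ge0// ltW.
rewrite ler_pdivrMr// (le_trans _ (_ : e * d <= _)) ?ler_pM2l//.
rewrite (le_trans _ (ltW qe))// (le_trans _ (ler_norm _))//.
by rewrite lerXn2r// nnegrE (le_trans (q_ge0 x)).
Qed.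

End CalEAlgebra.

(** * Characters are limits along ultrafilters *)
Section Characters.
Context {R : realType} {X : vectType R}.
Implicit Types (u v : calE_type X) (phi : calE_type X -> R[i]).

Lemma calE_typeP u : calE (u : X -> R[i]).
Proof. by case: u => u /= /asboolP. Qed.

Definition mk_calE (w : X -> R[i]) (Ew : calE w) : calE_type X :=
  CalE (asboolT Ew : w \in @in_calE R X).

Lemma calE_type_inj u v : (forall x, u x = v x) -> u = v.
Proof. by move=> uv; apply: val_inj; apply/funext. Qed.

Section Kernel.
Context {phi : calE_type X -> R[i]} (phiP : character phi).

Lemma character_lin k u v : phi (k *: u + v) = k * phi u + phi v.
Proof. by have [+ _ _] := phiP; apply. Qed.

Lemma characterM u v : phi (u * v) = phi u * phi v.
Proof. by have [_ + _] := phiP; apply. Qed.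

Lemma character1 : phi 1 = 1.
Proof.
have [_ _ [f f0]] := phiP; apply: (mulfI f0).
by rewrite -characterM !mulr1.
Qed.

Lemma character0 : phi 0 = 0.
Proof.
by have := character_lin (-1) 0 0; rewrite scaler0 addr0 mulN1r addNr.
Qed.

Lemma characterD u v : phi (u + v) = phi u + phi v.
Proof. by have := character_lin 1 u v; rewrite scale1r mul1r. Qed.

(** The function [|u| ^ 2], as an element of the algebra that is a multiple
    of [u]: it lies in the kernel of every character that kills [u]. *)
Definition calE_sqnorm u : calE_type X :=
  u * mk_calE (calE_conj (calE_typeP u)).

Lemma calE_sqnormE u x : calE_sqnorm u x = `|u x| ^+ 2.
Proof. by rewrite sqr_normc. Qed.

Lemma character_sqnorm u : phi u = 0 -> phi (calE_sqnorm u) = 0.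
Proof. by move=> u0; rewrite characterM u0 mul0r. Qed.

(** Otherwise [|u| ^ 2] would be bounded away from zero, hence invertible in the
    algebra, and a character cannot kill an invertible element. *)
Lemma kernel_small u (e : R) : phi u = 0 -> 0 < e -> exists x, `|u x| < e%:C.
Proof.
move=> u0 e0; apply: contrapT => nx.
have ue x : e%:C <= `|u x|.
  rewrite real_leNgt ?normr_real//; last by apply/complex_realP; exists e.
  by apply/negP => xe; apply: nx; exists x.
pose g x := Re (`|u x| ^+ 2).
have gE x : (g x)%:C = `|u x| ^+ 2.
  by rewrite /g normc_def -rmorphXn.
have g_ge x : e ^+ 2 <= g x.
  by rewrite -lecR gE rmorphXn lerXn2r ?nnegrE// ler0c ltW.
have Eg : calE (fun x => (g x)%:C).
  have := calE_typeP (calE_sqnorm u); congr calE.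
  by apply/funext => x; rewrite gE -calE_sqnormE.
have e20 : 0 < e ^+ 2 by rewrite exprn_gt0.
pose h := mk_calE (calE_inv e20 g_ge Eg).
have : phi (calE_sqnorm u * h) = 1.
  rewrite -character1; congr phi; apply: calE_type_inj => x.
  transitivity (calE_sqnorm u x * h x); first by [].
  rewrite calE_sqnormE -gE /= -rmorphM mulfV//.
  by rewrite gt_eqF// (lt_le_trans e20).
rewrite characterM character_sqnorm// mul0r => /esym/eqP.
by rewrite oner_eq0.
Qed.

(** The sets [{x | |u x| < e}] with [phi u = 0] are a filter base:
    they are nonempty, and the set attached to [|u| ^ 2 + |v| ^ 2], which is again
    in the kernel, is contained in those of [u] and [v]. Along an ultrafilter
    containing them [u - phi u] tends to zero for every [u]. *)
Lemma character_limit : exists2 F, UltraFilter F & forall u, ctends F u (phi u).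
Proof.
pose D := [set ue : calE_type X * R | phi ue.1 = 0 /\ 0 < ue.2].
pose B (ue : calE_type X * R) := [set x | `|ue.1 x| < ue.2%:C].
have FP : ProperFilter (filter_from D B).
  apply: filter_from_proper; last first.
    by move=> [u e] [/= u0 e0]; exact: kernel_small.
  apply: filter_from_filter; first exists (0, 1).
    by split=> //=; exact: character0.
  move=> [u d] [v e] [/= u0 d0] [/= v0 e0].
  pose m := Num.min d e.
  have m0 : 0 < m by rewrite lt_min d0.
  exists (calE_sqnorm u + calE_sqnorm v, m ^+ 2).
    by split; rewrite /= ?exprn_gt0// characterD !character_sqnorm// addr0.
  have sm (c : R[i]) b : `|c| ^+ 2 < (m ^+ 2)%:C -> m <= b -> `|c| < b%:C.
    rewrite rmorphXn ltr_pXn2r ?nnegrE//= ?ler0c ?(ltW m0)// => cm mb.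
    by rewrite (lt_le_trans cm)// lecR.
  move=> x; rewrite /B/= => xm.
  have {}xm : `|u x| ^+ 2 + `|v x| ^+ 2 < (m ^+ 2)%:C.
    move: xm; rewrite -!calE_sqnormE.
    by rewrite ger0_norm// /calE_sqnorm/= addr_ge0// mulcJ_ge0.
  split; apply: sm; rewrite ?ge_min ?lexx ?orbT//.
  - by rewrite (le_lt_trans _ xm)// lerDl exprn_ge0.
  - by rewrite (le_lt_trans _ xm)// lerDr exprn_ge0.
have [G [GU FG]] := ultraFilterLemma FP.
exists G => // u; have GP := @ultra_proper _ _ GU.
apply/ctendsP => e e0; apply: FG.
exists ((- phi u) *: (1 : calE_type X) + u, e).
  by split; rewrite //= character_lin character1 mulr1 addNr.
move=> x; rewrite /B/= => xe.
rewrite (_ : u x - phi u = - phi u * 1 + u x)//.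
by rewrite mulr1 addrC.
Qed.

End Kernel.
End Characters.

(** * Uniqueness of the limit in Omega *)
Section Uniqueness.
Context {R : realType} {X : vectType R}.
Implicit Types (Y W : {vspace X}) (F : set_system X).

(** The initial segment [a] carries the subspace it spans, since the type of a
    sequence depends on that subspace. *)
Fixpoint prefix (a : {Y : {vspace X} & hlseq Y}) Y (s : hlseq Y) : Prop :=
  a = existT _ Y s \/
  match s with hlnil => False | hlcons _ s0 _ => prefix a s0 end.

Lemma prefix_refl Y (s : hlseq Y) : prefix (existT _ Y s) s.
Proof. by case: s => [|Y0 s0 alpha]; left. Qed.

Lemma prefix_nil Y (s : hlseq Y) : prefix (existT _ 0%VS (hlnil X)) s.
Proof. by elim: s => [|Y0 s0 IH alpha]; [left|right]. Qed.

Lemma follows_prefix F a Y (s : hlseq Y) :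
  prefix a s -> follows F s -> follows F (projT2 a).
Proof.
elim: s => [|Y0 s0 IH alpha] /= [->//|//] as0 [s0F _].
exact: IH.
Qed.

Lemma prefixP a Y (s : hlseq Y) : prefix a s ->
  a = existT _ Y s \/
  exists alpha, prefix (existT _ _ (hlcons (projT2 a) alpha)) s.
Proof.
elim: s => [|Y0 s0 IH beta] /= [->|//]; try by left.
move=> /IH[->|[alpha a_s0]]; right; first by exists beta; left.
by exists alpha; right.
Qed.

(** At the first place where two followed sequences differ, the filter would
    tend to two distinct half-lines of the same quotient. *)
Lemma follows_comparable F Y (s : hlseq Y) Y' (s' : hlseq Y') :
  ProperFilter F ->
  follows F s -> follows F s' ->
  prefix (existT _ Y s) s' \/ prefix (existT _ Y' s') s.
Proof.
move=> FF; elim: s => [|Y0 s0 IH alpha] /=; first by left; exact: prefix_nil.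
move=> [s0F Fa] s'F; have [/prefixP[e|[beta s0s']]|s's0] := IH s0F s'F.
- by right; right; rewrite -e; exact: prefix_refl.
- have [_ Fb] := follows_prefix s0s' s'F.
  by have [->] := tends_unique FF Fa Fb; left.
- by right; right.
Qed.

(** If one sequence were a proper initial segment of the other, the filter would
    tend to both a point and a half-line of the same quotient. *)
Lemma converges_to_unique F p q : ProperFilter F ->
  converges_to F p -> converges_to F q -> p = q.
Proof.
move=> FF; case: p q => Y [z s] [Y' [z' s']]; rewrite /converges_to/=.
move=> [sF Fz] [s'F Fz'].
have same (a b : {Y : {vspace X} & hlseq Y}) t t' : a = b ->
    tends F (prv (projT1 a)) (inl t) -> tends F (prv (projT1 b)) (inl t') ->
    existT _ (projT1 a) (t, projT2 a) =
    existT _ (projT1 b) (t', projT2 b) :> Omega X.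
  move=> ab; case: _ / ab t' => t' Ft Ft'.
  by have [->] := tends_unique FF Ft Ft'.
have [/prefixP[e|[alpha /follows_prefix]]|
      /prefixP[e|[alpha /follows_prefix]]] :=
  follows_comparable FF sF s'F.
- exact: (same _ _ _ _ e).
- by move=> /(_ _ s'F)/=[_ /(tends_unique FF Fz)].
- exact/esym/(same _ _ _ _ e).
- by move=> /(_ _ sF)/=[_ /(tends_unique FF Fz')].
Qed.

End Uniqueness.

(** * The bijection *)
Section Bijection.
Context {R : realType} {X : vectType R}.
Implicit Types (p q : Omega X).

Definition limit_filter p : set_system X := iterated (projT2 p).2 (projT2 p).1.

Lemma limit_filter_converges p : converges_to (limit_filter p) p.
Proof. by case: p => Y [z s]; exact: iterated_converges. Qed.

Lemma chi_limit p (u : calE_type X) : ctends (limit_filter p) u (chi p u).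
Proof. by apply: tau_seq_iterated; exact: calE_typeP. Qed.

Lemma chi_character p : character (@chi R X p).
Proof.
have FF : ProperFilter (limit_filter p) by exact: iterated_proper.
split=> [k u v|u v|].
- apply: ctends_unique (chi_limit p _) _.
  apply: ctendsD; last exact: chi_limit.
  by apply: ctendsM; [exact: ctends_cst|exact: chi_limit].
- apply: ctends_unique (chi_limit p _) _.
  by apply: ctendsM; exact: chi_limit.
- exists 1; rewrite (_ : chi p 1 = 1) ?oner_neq0//.
  exact: ctends_unique (chi_limit p _) (ctends_cst _ _).
Qed.

(** The values of [chi q] on functions that factor through [X / W] determine the
    limit in the compactification of [X / W], so the filter of [q] follows the
    sequence of [p] and tends to the point of [p]. *)
Lemma chi_inj p q : chi p = chi q :> (calE_type X -> R[i]) -> p = q.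
Proof.
have FF p' : ProperFilter (limit_filter p') by exact: iterated_proper.
move=> pq.
have transfer W r :
    tends (limit_filter p) (prv W) r -> tends (limit_filter q) (prv W) r.
  apply: tends_separated => u c uC uc.
  have Eu : calE (u \o prv W).
    by apply: sub_gen_smallest; exists W => //; exists u.
  have := chi_limit q (mk_calE Eu); rewrite -pq.
  by rewrite (ctends_unique (FF p) (chi_limit p (mk_calE Eu)) uc).
apply: (converges_to_unique (FF q)) (limit_filter_converges q).
have := limit_filter_converges p; rewrite /converges_to.
case: p {pq} transfer => Y [z s]/= transfer [sF /transfer Fz]; split => //.
move: sF; move: (limit_filter _) transfer => G transfer.
elim: s {z Fz} G transfer => //= Y0 s0 IH alpha G transfer [s0G /transfer].
split => //; exact: IH s0G.
Qed.

Lemma chi_surj phi : character phi -> exists p, chi p = phi.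
Proof.
move=> phiP; have [F FU uphi] := character_limit phiP.
have [p Fp] := ultra_converges FU; exists p; apply/funext => u.
have [c uc] := calE_converges_to p (calE_typeP u).
have FF := @ultra_proper _ _ FU.
rewrite (ctends_unique FF (uphi u) (uc _ FF Fp)).
have GF : ProperFilter (limit_filter p) by exact: iterated_proper.
exact: ctends_unique (chi_limit p u) (uc _ GF (limit_filter_converges p)).
Qed.

End Bijection.

Theorem theorem6p14 (R : realType) (X : vectType R)
    (dimX : (2 <= \dim {:X})%N) :
  set_bij [set: Omega X] [set f | @character R X f] (@chi R X).
Proof.
split=> [p _|p q _ _|phi /= phiP].
- exact: chi_character.
- exact: chi_inj.
- by have [p pphi] := chi_surj phiP; exists p.
Qed.
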